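(* Let $\alpha\in\mathbb{C}$ and let $A_\alpha$ be the 3-dimensional complex $\omega$-Lie algebra with basis $\{x,y,z\}$, bracket determined by $[x,y]=x$, $[x,z]=x+y$, $[y,z]=z+\alpha x$, and form $\omega$ determined by $\omega(x,y)=\omega(x,z)=0$, $\omega(y,z)=-1$. Then: (1) $\mathrm{Aut}(A_\alpha)$ is a connected, abelian matrix Lie group. (2) $\mathrm{Aut}(A_\alpha)=\exp(\mathrm{Der}(A_\alpha))$.
   Context: An $\omega$-Lie algebra over $\mathbb{C}$ is a triple $(\mathfrak{g},[-,-],\omega)$ where $\mathfrak{g}$ is a finite-dimensional complex vector space, $[-,-]$ is a skew-symmetric bilinear bracket on $\mathfrak{g}$ and $\omega:\mathfrak{g}\times\mathfrak{g}\to\mathbb{C}$ is a skew-symmetric bilinear form such that $$[[x,y],z]+[[y,z],x]+[[z,x],y]=\omega(x,y)z+\omega(y,z)x+\omega(z,x)y$$ for all $x,y,z\in\mathfrak{g}$. $\mathrm{Der}(\mathfrak{g})$ is the Lie algebra of all linear maps $d:\mathfrak{g}\to\mathfrak{g}$ with $d([x,y])=[d(x),y]+[x,d(y)]$ for all $x,y\in\mathfrak{g}$. $\mathrm{Aut}(\mathfrak{g})$ is the group of all linear isomorphisms $\rho:\mathfrak{g}\to\mathfrak{g}$ with $\rho([x,y])=[\rho(x),\rho(y)]$ for all $x,y\in\mathfrak{g}$. Using the given basis, linear maps of $A_\alpha$ are identified with $3\times 3$ complex matrices, so $\mathrm{Der}(A_\alpha)\subseteq\mathfrak{gl}_3(\mathbb{C})$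 and $\mathrm{Aut}(A_\alpha)\subseteq\mathrm{GL}(3,\mathbb{C})$; $\exp(X)=\sum_{k\ge 0}X^k/k!$ is the matrix exponential and $\exp(\mathrm{Der}(A_\alpha))=\{\exp(d)\mid d\in\mathrm{Der}(A_\alpha)\}$. A matrix Lie group is a closed subgroup of a general linear group $\mathrm{GL}(n,\mathbb{C})$; connected means path-connected as a topological space. *)

(* Defs.v *)
From HB Require Import structures.
From mathcomp Require Import all_boot all_order all_algebra sesquilinear.
From mathcomp Require Import complex ring.
From mathcomp Require Import all_classical all_reals all_analysis.

Set Implicit Arguments.
Unset Strict Implicit.
Unset Printing Implicit Defensive.

Import Order.TTheory GRing.Theory Num.Theory.
Import numFieldNormedType.Exports.

Local Open Scope classical_set_scope.
Local Open Scope ring_scope.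

(* [R[i]] carries its topology only as a [numClosedFieldType]; without this
   cast matrices over [R[i]] are not recognised as a topological space. *)
Definition Cplx (R : realType) : numClosedFieldType := complex R.

Record omegaLieAlgebra (R : realType) := OmegaLieAlgebra {
  ol_space :> vectType (Cplx R);
  bracket : {bilinear ol_space -> ol_space -> ol_space};
  omega : {biscalar ol_space};
  bracket_skew : forall x y : ol_space, bracket x y = - bracket y x;
  omega_skew : forall x y : ol_space, omega x y = - omega y x;
  omega_jacobi : forall x y z : ol_space,
    bracket (bracket x y) z + bracket (bracket y z) x + bracket (bracket z x) y
    = omega x y *: z + omega y z *: x + omega z x *: y
}.

Definition Der (R : realType) (g : omegaLieAlgebra R) : set {linear g -> g} :=
  [set d : {linear g -> g} | forall x y : g,
     d (bracket g x y) = bracket g (d x) y + bracket g x (d y)].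

Definition Aut (R : realType) (g : omegaLieAlgebra R) : set {linear g -> g} :=
  [set rho : {linear g -> g} | bijective rho /\
     forall x y : g, rho (bracket g x y) = bracket g (rho x) (rho y)].

Section Aalpha.
Variables (R : realType) (alpha : Cplx R).
Local Notation V := 'cV[Cplx R]_3.

Definition basis_x : V := delta_mx (inord 0) 0.
Definition basis_y : V := delta_mx (inord 1) 0.
Definition basis_z : V := delta_mx (inord 2) 0.

Definition minor (u v : V) (i j : nat) : Cplx R :=
  u (inord i) 0 * v (inord j) 0 - u (inord j) 0 * v (inord i) 0.

(* The skew-symmetric bilinear extension of the values on pairs of basis
   vectors: [x,y] = x, [x,z] = x + y, [y,z] = z + alpha x. *)
Definition A_bracket (u v : V) : V :=
  minor u v 0 1 *: basis_x
  + minor u v 0 2 *: (basis_x + basis_y)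
  + minor u v 1 2 *: (basis_z + alpha *: basis_x).

Definition A_omega (u v : V) : Cplx R := minor u v 1 2 * (-1).

Lemma ord3E (i : 'I_3) : [\/ i = inord 0, i = inord 1 | i = inord 2].
Proof.
case: i => -[|[|[|//]]] lti; [apply: Or31|apply: Or32|apply: Or33];
  by apply/val_inj; rewrite /= inordK.
Qed.

Lemma inord3_eq (i j : nat) : (i < 3)%N -> (j < 3)%N ->
  ((inord i : 'I_3) == inord j) = (i == j).
Proof. by move=> li lj; rewrite -val_eqE /= !inordK. Qed.

Lemma A_bracket0 (u v : V) : A_bracket u v (inord 0) 0
  = minor u v 0 1 + minor u v 0 2 + alpha * minor u v 1 2.
Proof. by rewrite !mxE !inord3_eq //=; ring. Qed.

Lemma A_bracket1 (u v : V) : A_bracket u v (inord 1) 0 = minor u v 0 2.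
Proof. by rewrite !mxE !inord3_eq //=; ring. Qed.

Lemma A_bracket2 (u v : V) : A_bracket u v (inord 2) 0 = minor u v 1 2.
Proof. by rewrite !mxE !inord3_eq //=; ring. Qed.

Lemma colE3 (u v : V) : u (inord 0) 0 = v (inord 0) 0 ->
  u (inord 1) 0 = v (inord 1) 0 -> u (inord 2) 0 = v (inord 2) 0 -> u = v.
Proof. by move=> e0 e1 e2; apply/colP => i; case: (ord3E i) => ->. Qed.

Local Ltac gen u :=
  move: (u (inord 0) 0) (u (inord 1) 0) (u (inord 2) 0); do 3 intro.

(* [A_bracket] is generalized so that [mxE] cannot unfold it. *)
Local Ltac entries :=
  move: A_bracket A_bracket0 A_bracket1 A_bracket2;
  let B := fresh "B" in let B0 := fresh "B0" in
  let B1 := fresh "B1" in let B2 := fresh "B2" in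
  intros B B0 B1 B2;
  apply: colE3; rewrite !mxE ?(B0, B1, B2) /minor ?(B0, B1, B2) ?mxE /minor.

Lemma A_bracket_bilinear : bilinear_for *:%R *:%R A_bracket.
Proof. by split=> w a u v; entries; gen u; gen v; gen w; ring. Qed.

Lemma A_omega_bilinear : bilinear_for *%R *%R A_omega.
Proof.
split=> w a u v; rewrite /A_omega /minor !mxE; gen u; gen v; gen w;
  by rewrite /=; ring.
Qed.

HB.instance Definition _ := bilinear_isBilinear.Build _ _ _ _ _ _
  A_bracket A_bracket_bilinear.
HB.instance Definition _ := bilinear_isBilinear.Build _ _ _ _ _ _
  A_omega A_omega_bilinear.

Lemma A_bracket_skew (u v : V) : A_bracket u v = - A_bracket v u.
Proof. by entries; gen u; gen v; ring. Qed.

Lemma A_omega_skew (u v : V) : A_omega u v = - A_omega v u.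
Proof. by rewrite /A_omega /minor; ring. Qed.

Lemma A_jacobi (u v w : V) :
  A_bracket (A_bracket u v) w + A_bracket (A_bracket v w) u
    + A_bracket (A_bracket w u) v
  = A_omega u v *: w + A_omega v w *: u + A_omega w u *: v.
Proof. by rewrite /A_omega; entries; gen u; gen v; gen w; ring. Qed.

Definition A : omegaLieAlgebra R :=
  @OmegaLieAlgebra R V A_bracket A_omega
    A_bracket_skew A_omega_skew A_jacobi.

Lemma minor_delta (i j k l : nat) :
    (i < 3)%N -> (j < 3)%N -> (k < 3)%N -> (l < 3)%N ->
  minor (delta_mx (inord i) 0) (delta_mx (inord j) 0) k l
  = (k == i)%:R * (l == j)%:R - (l == i)%:R * (k == j)%:R.
Proof. by move=> *; rewrite /minor !mxE !inord3_eq // !andbT. Qed.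

Local Ltac on_basis :=
  rewrite /= /A_bracket /A_omega !minor_delta //=
    ?(oppr0, mulr0, mul0r, mulr1, mul1r, subr0, subrr,
      scale0r, scale1r, add0r, addr0).

Lemma A_bracket_xy : bracket A basis_x basis_y = basis_x :> V.
Proof. by on_basis. Qed.

Lemma A_bracket_xz : bracket A basis_x basis_z = basis_x + basis_y :> V.
Proof. by on_basis. Qed.

Lemma A_bracket_yz :
  bracket A basis_y basis_z = basis_z + alpha *: basis_x :> V.
Proof. by on_basis. Qed.

Lemma A_omega_xy : omega A basis_x basis_y = 0.
Proof. by on_basis. Qed.

Lemma A_omega_xz : omega A basis_x basis_z = 0.
Proof. by on_basis. Qed.

Lemma A_omega_yz : omega A basis_y basis_z = -1.
Proof. by on_basis. Qed.

(* A matrix M is identified with the linear map v |-> M v on coordinate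
   columns: column j of M holds the coordinates of the image of the j-th basis
   vector, and composition of maps is matrix multiplication. *)
Definition mx_map (M : 'M[Cplx R]_3) : {linear A -> A} := mulmx M.

Definition DerA : set 'M[Cplx R]_3 := [set M | Der (mx_map M)].
Definition AutA : set 'M[Cplx R]_3 := [set M | Aut (mx_map M)].

End Aalpha.

Section MatrixGroups.
Variable R : realType.

Definition expmx n (X : 'M[Cplx R]_n.+1) : 'M[Cplx R]_n.+1 :=
  lim (series (fun k => (k`!%:R)^-1 *: X ^+ k) @ \oo).

Definition GL n : set 'M[Cplx R]_n := [set M | M \in unitmx].

Definition subgroup_GL n (G : set 'M[Cplx R]_n) : Prop :=
  [/\ G `<=` @GL n, G 1%:M,
      (forall M N, G M -> G N -> G (M *m N)) &
      (forall M, G M -> G (invmx M))].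

(* Closed in the topology induced on GL(n, C), not necessarily in M_n(C). *)
Definition matrix_lie_group n (G : set 'M[Cplx R]_n) : Prop :=
  subgroup_GL G /\ closed (G : set (subspace (@GL n))).

Definition abelian_mx n (G : set 'M[Cplx R]_n) : Prop :=
  forall M N, G M -> G N -> M *m N = N *m M.

Definition path_connected n (G : set 'M[Cplx R]_n) : Prop :=
  forall M N, G M -> G N -> exists gamma : R -> 'M[Cplx R]_n,
    [/\ {within `[0, 1], continuous gamma}, gamma 0 = M, gamma 1 = N &
        forall t, t \in `[0, 1] -> G (gamma t)].

End MatrixGroups.

(* Main.v *)
Require Import Defs.
From HB Require Import structures.
From mathcomp Require Import all_boot all_order all_algebra.
From mathcomp Require Import all_classical all_reals all_analysis.
From mathcomp Require Import complex ring.
Import Order.TTheory GRing.Theory Num.Theory.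
Import numFieldNormedType.Exports.
Local Open Scope classical_set_scope.
Local Open Scope ring_scope.

(** An automorphism preserves omega: apply it to the Jacobi identity and compare
    with the Jacobi identity of the images ([aut_omega]). Hence it preserves the
    radical of omega, the line of x, so x is sent to a x with a nonzero. Feeding
    this into the three bracket relations fixes every other coordinate except
    one, namely the coefficient b of x in the image of y, and forces a = 1:
<<
      x |-> x,   y |-> b x + y,   z |-> (b^2 + b)/2 x + b y + z.
>>
    The same relations, linearized, show that the derivations are the multiples
    b N of a single matrix N ([der_eq]):
<<
      x |-> 0,   y |-> x,   z |-> x/2 + y.
>>
    Since N^3 = 0, the exponential of b N is the polynomial
    1 + b N + b^2/2 N^2, called [flow b] below, and it is exactly the
    automorphism displayed above ([aut_eq], [flow_aut]). This proves
    Aut = exp(Der).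

    Everything else follows from this parametrization of Aut by C. The identity
    [flow b * flow c = flow (b + c)] makes Aut an abelian group. It is
    path-connected because the segment from b to c in C is carried by the
    continuous map [flow] to a path from [flow b] to [flow c]. It is closed
    because it is the graph of a continuous function: the parameter b is itself
    an entry of the matrix, so that M lies in Aut if and only if
    M = [flow] (M 0 1). *)

(** * Nilpotent exponentials and continuity *)

(** The partial sums of the exponential series are constant from the m-th on, so
    the limit is reached and no convergence question arises. *)
Lemma expmx_nilpotent {R : realType} {n : nat} (m : nat)
    (X : 'M[Cplx R]_n.+1) :
  X ^+ m = 0 -> expmx X = \sum_(0 <= k < m) (k`!%:R)^-1 *: X ^+ k.
Proof.
move=> Xm0; apply: lim_near_cst; first exact: norm_hausdorff.
near=> k; have le_mk : (m <= k)%N by near: k; exact: nbhs_infty_ge.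
rewrite /series /= (big_cat_nat (leq0n m) le_mk) /=
  [X in _ + X]big_nat_cond.
rewrite [X in _ + X]big1 ?addr0 // => j /andP[/andP[le_mj _] _].
by rewrite -(subnK le_mj) exprD Xm0 mulr0 scaler0.
Unshelve. all: by end_near. Qed.

Lemma continuous_quadratic {K : numFieldType} {m n : nat}
    (A B D : 'M[K]_(m.+1, n.+1)) :
  continuous (fun b : K => A + b *: B + (b ^+ 2 / 2) *: D).
Proof.
move=> b; have b_id : x @[x --> b] --> b by exact: cvg_id.
exact: cvgD (cvgD (cvg_cst _) (cvgZr_tmp b_id))
            (cvgZr_tmp (cvgM (cvgM b_id b_id) (cvg_cst _))).
Qed.

Lemma continuous_affine {K : numFieldType} {T : topologicalType} (b c : K)
    (f : T -> K) :
  continuous f -> continuous (fun t => b + f t * c).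
Proof.
by move=> f_cont t; exact: cvgD (cvg_cst _) (cvgM (f_cont t) (cvg_cst _)).
Qed.

(** A family of matrices whose parameter can be read off continuously as one of
    the entries is a closed set: it is the zero set of M - f (M i j). *)
Lemma closed_entry_graph {K : numFieldType} {m n : nat} (i : 'I_m.+1)
    (j : 'I_n.+1) (f : K -> 'M[K]_(m.+1, n.+1)) :
  continuous f -> closed [set M : 'M[K]_(m.+1, n.+1) | M = f (M i j)].
Proof.
move=> f_cont; pose g (M : 'M[K]_(m.+1, n.+1)) := M - f (M i j).
rewrite (_ : mkset _ = g @^-1` [set 0]); last first.
  by apply/seteqP; split=> M /= /eqP M_eq; apply/eqP; move: M_eq;
    rewrite subr_eq0.
apply: preimage_closed => [M _|].
  have fij_cont : {for M, continuous (fun P : 'M[K]_(m.+1, n.+1) => f (P i j))}.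
    exact: (@continuous_comp _ _ _ (fun P : 'M[K]_(m.+1, n.+1) => P i j) f M
      (@coord_continuous K _ _ i j M) (f_cont _)).
  have M_id : P @[P --> M] --> M by exact: cvg_id.
  exact: cvgB M_id fij_cont.
apply: accessible_closed_set1; apply: hausdorff_accessible.
exact: norm_hausdorff.
Qed.

Lemma continuous_real_complex {R : realType} :
  continuous (fun t : R => (t%:C)%C : Cplx R).
Proof.
move=> s; apply/cvgrPdist_lt => e e0.
have [r er] : exists r : R, e = (r%:C)%C.
  by apply/complex_realP; exact: gtr0_real.
move: e0; rewrite er (ltcR 0 r) => r0.
near=> t; rewrite -rmorphB normc_def /= expr0n addr0 sqrtr_sqr ltcR.
by near: t; exact: cvgr_dist_lt.
Unshelve. all: by end_near. Qed.

(** * Automorphisms preserve the form *)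

(** Both sides are Jacobi sums: the image under rho of the left-hand side is the
    Jacobi sum of the images, which is also the image of the right-hand side;
    rho is injective. *)
Lemma aut_omega {R : realType} (g : omegaLieAlgebra R)
    (rho : {linear g -> g}) (x y z : g) :
  Aut rho ->
  omega g x y *: z + omega g y z *: x + omega g z x *: y
  = omega g (rho x) (rho y) *: z + omega g (rho y) (rho z) *: x
    + omega g (rho z) (rho x) *: y.
Proof.
move=> [/bij_inj rho_inj rhoB]; apply: rho_inj.
by rewrite -omega_jacobi !linearD !rhoB omega_jacobi !linearZ.
Qed.

Section Aalpha.
Variables (R : realType) (alpha : Cplx R).
Local Notation C := (Cplx R).
Local Notation i0 := (inord 0 : 'I_3).
Local Notation i1 := (inord 1 : 'I_3).
Local Notation i2 := (inord 2 : 'I_3).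

(** * Coordinates *)

(** Solves a linear equation: it reduces p = q to an identity by exhibiting
    p - q as the difference of the two sides of a known equation. *)
Lemma eq_of_subr {l r p q : C} : l = r -> p - q = l - r -> p = q.
Proof. by move=> -> /eqP; rewrite subrr subr_eq0 => /eqP. Qed.

Lemma two_mul_inj (p q : C) : 2 * p = 2 * q -> p = q.
Proof. by apply: mulfI; rewrite pnatr_eq0. Qed.

Lemma mulmx3E (M : 'M[C]_3) (u : 'cV[C]_3) (i : 'I_3) :
  (M *m u) i 0 = M i i0 * u i0 0 + M i i1 * u i1 0 + M i i2 * u i2 0.
Proof.
rewrite mxE !big_ord_recl big_ord0 addr0 addrA.
by congr (_ * _ + _ * _ + _ * _); congr (fun_of_matrix _ _ _);
  apply/val_inj; rewrite /= inordK.
Qed.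

Lemma mulmx_deltaE (M : 'M[C]_3) (i j : 'I_3) :
  (M *m delta_mx j (0 : 'I_1)) i 0 = M i j.
Proof. by rewrite -colE mxE. Qed.

Lemma mulmx_inj (M P : 'M[C]_3) :
  (forall u : 'cV[C]_3, M *m u = P *m u) -> M = P.
Proof.
move=> MP; apply/matrixP => i j.
by rewrite -(mulmx_deltaE M) MP mulmx_deltaE.
Qed.

Lemma x_coord :
  [/\ basis_x R i0 0 = 1, basis_x R i1 0 = 0 & basis_x R i2 0 = 0].
Proof. by rewrite !mxE !inord3_eq. Qed.

Lemma y_coord :
  [/\ basis_y R i0 0 = 0, basis_y R i1 0 = 1 & basis_y R i2 0 = 0].
Proof. by rewrite !mxE !inord3_eq. Qed.

Lemma z_coord :
  [/\ basis_z R i0 0 = 0, basis_z R i1 0 = 0 & basis_z R i2 0 = 1].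
Proof. by rewrite !mxE !inord3_eq. Qed.

Lemma basis_free (p q r p' q' r' : C) :
  p *: basis_x R + q *: basis_y R + r *: basis_z R
  = p' *: basis_x R + q' *: basis_y R + r' *: basis_z R ->
  [/\ p = p', q = q' & r = r'].
Proof.
have [x0 x1 x2] := x_coord; have [y0 y1 y2] := y_coord.
have [z0 z1 z2] := z_coord.
move: (basis_x R) (basis_y R) (basis_z R) x0 x1 x2 y0 y1 y2 z0 z1 z2.
move=> x y z x0 x1 x2 y0 y1 y2 z0 z1 z2.
have combE s t v i : (s *: x + t *: y + v *: z) i 0
    = s * x i 0 + t * y i 0 + v * z i 0 by rewrite !mxE.
move=> eq_pq; have eq_i i := congr1 (fun w : 'cV[C]_3 => w i 0) eq_pq.
move: (eq_i i0) (eq_i i1) (eq_i i2) => {eq_i eq_pq} /=; rewrite !combE.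
by rewrite x0 x1 x2 y0 y1 y2 z0 z1 z2 !mulr0 !mulr1 !addr0 !add0r.
Qed.

Lemma mulmx_x (M : 'M[C]_3) i : (M *m basis_x R) i 0 = M i i0.
Proof. exact: mulmx_deltaE. Qed.

Lemma mulmx_y (M : 'M[C]_3) i : (M *m basis_y R) i 0 = M i i1.
Proof. exact: mulmx_deltaE. Qed.

Lemma mulmx_z (M : 'M[C]_3) i : (M *m basis_z R) i 0 = M i i2.
Proof. exact: mulmx_deltaE. Qed.

Lemma mulmx_xy (M : 'M[C]_3) i :
  (M *m (basis_x R + basis_y R)) i 0 = M i i0 + M i i1.
Proof. by rewrite mulmxDr mxE mulmx_x mulmx_y. Qed.

Lemma mulmx_zx (M : 'M[C]_3) i :
  (M *m (basis_z R + alpha *: basis_x R)) i 0 = M i i2 + alpha * M i i0.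
Proof. by rewrite mulmxDr -scalemxAr mxE [X in _ + X]mxE mulmx_x mulmx_z. Qed.

(** * The generating derivation and its one-parameter group *)

Definition der_gen : 'M[C]_3 :=
  delta_mx i0 i1 + 2^-1 *: delta_mx i0 i2 + delta_mx i1 i2.
Local Notation N := der_gen.

Lemma der_gen_coord0 (u : 'cV[C]_3) : (N *m u) i0 0 = u i1 0 + 2^-1 * u i2 0.
Proof. by rewrite mulmx3E !mxE !inord3_eq //=; ring. Qed.

Lemma der_gen_coord1 (u : 'cV[C]_3) : (N *m u) i1 0 = u i2 0.
Proof. by rewrite mulmx3E !mxE !inord3_eq //=; ring. Qed.

Lemma der_gen_coord2 (u : 'cV[C]_3) : (N *m u) i2 0 = 0.
Proof. by rewrite mulmx3E !mxE !inord3_eq //=; ring. Qed.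

Definition der_genE := (der_gen_coord0, der_gen_coord1, der_gen_coord2).

Lemma der_gen_cube : N ^+ 3 = 0.
Proof.
apply: mulmx_inj => u; rewrite [N ^+ 3]/(N *m (N *m N)) -!mulmxA mul0mx.
by apply: colE3; rewrite ?der_genE mxE // mulr0 addr0.
Qed.

Definition flow (b : C) : 'M[C]_3 := 1%:M + b *: N + (b ^+ 2 / 2) *: (N *m N).

Lemma expmx_der_gen (b : C) : expmx (b *: N) = flow b.
Proof.
rewrite (expmx_nilpotent 3) ?exprZn ?der_gen_cube ?scaler0 //.
rewrite (big_ltn (isT : 0 < 3)%N) (big_ltn (isT : 1 < 3)%N).
rewrite (big_ltn (isT : 2 < 3)%N) (big_geq (isT : 3 <= 3)%N) addr0 addrA.
rewrite /flow !exprZn !scalerA -[0`!]/1%N -[1`!]/1%N -[2`!]/2%N.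
rewrite !expr0 !expr1 invr1 !mul1r scale1r.
by rewrite [N ^+ 2]/(N *m N) [_ * b ^+ 2]mulrC.
Qed.

Lemma flow0 : flow 0 = 1%:M.
Proof. by rewrite /flow !scale0r expr0n mul0r scale0r !addr0. Qed.

Lemma flow_continuous : continuous flow.
Proof. exact: continuous_quadratic. Qed.

Lemma flow_coord (b : C) (u : 'cV[C]_3) (i : 'I_3) :
  (flow b *m u) i 0
  = u i 0 + b * (N *m u) i 0 + b ^+ 2 / 2 * (N *m (N *m u)) i 0.
Proof.
rewrite /flow 2!mulmxDl mul1mx -(scalemxAl b) -(scalemxAl (_ / 2)) mulmxA.
by move: (N *m u) (N *m N *m u) => v w; rewrite !mxE.
Qed.

(** Together with the next two formulas, this identifies the exponential of
    b N with the automorphism of parameter b. *)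
Lemma flow_coord0 (b : C) (u : 'cV[C]_3) :
  (flow b *m u) i0 0 = u i0 0 + b * u i1 0 + 2^-1 * (b ^+ 2 + b) * u i2 0.
Proof. by rewrite flow_coord !der_genE; ring. Qed.

Lemma flow_coord1 (b : C) (u : 'cV[C]_3) :
  (flow b *m u) i1 0 = u i1 0 + b * u i2 0.
Proof. by rewrite flow_coord !der_genE; ring. Qed.

Lemma flow_coord2 (b : C) (u : 'cV[C]_3) : (flow b *m u) i2 0 = u i2 0.
Proof. by rewrite flow_coord !der_genE; ring. Qed.

Definition flowE := (flow_coord0, flow_coord1, flow_coord2).

(* Below, these vectors, matrices and brackets are handled through their
   coordinates alone. *)
Local Opaque der_gen flow A_bracket basis_x basis_y basis_z.

Lemma flowD (b c : C) : flow b *m flow c = flow (b + c).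
Proof.
apply: mulmx_inj => u; rewrite -mulmxA; apply: colE3.
- by rewrite [LHS]flow_coord0 [RHS]flow_coord0 !flowE; field.
- by rewrite [LHS]flow_coord1 [RHS]flow_coord1 !flowE; ring.
- by rewrite [LHS]flow_coord2 [RHS]flow_coord2 flow_coord2.
Qed.

Lemma flow_unit (b : C) : flow b \in unitmx.
Proof.
by apply: (mulmx1_unit (B := flow (- b)) _).1; rewrite flowD subrr flow0.
Qed.

Lemma invmx_flow (b : C) : invmx (flow b) = flow (- b).
Proof. by rewrite -[RHS](mulKmx (flow_unit b)) flowD subrr flow0 mulmx1. Qed.

(** * Derivations *)

Lemma der_gen_der (b : C) : DerA alpha (b *: N).
Proof.
move=> u v; change ((b *: N) *m A_bracket alpha u v
  = A_bracket alpha ((b *: N) *m u) v + A_bracket alpha u ((b *: N) *m v)).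
have bNE (w : 'cV[C]_3) i : (b *: N *m w) i 0 = b * (N *m w) i 0.
  by rewrite -scalemxAl mxE.
have D0 w := etrans (bNE w i0) (congr1 ( *%R b) (der_gen_coord0 w)).
have D1 w := etrans (bNE w i1) (congr1 ( *%R b) (der_gen_coord1 w)).
have D2 w := etrans (bNE w i2) (congr1 ( *%R b) (der_gen_coord2 w)).
move: (b *: N) D0 D1 D2 {bNE} => D D0 D1 D2.
apply: colE3; rewrite [RHS]mxE ?(D0, D1, D2);
  rewrite ?(A_bracket0, A_bracket1, A_bracket2) /minor ?(D0, D1, D2); by field.
Qed.

(** The nine scalar equations expressing the derivation rule on the pairs
    (x,y), (x,z), (y,z) form a triangular linear system in the entries of M.
    Throughout, a, b and c name the columns of M, that is the images of x, y
    and z, and the digit the coordinate. *)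
Lemma der_eq (M : 'M[C]_3) : DerA alpha M -> M = M i0 i1 *: N.
Proof.
move=> derM.
have {}derM (u v w : 'cV[C]_3) i : A_bracket alpha u v = w ->
    (M *m w) i 0 = A_bracket alpha (M *m u) v i 0
                   + A_bracket alpha u (M *m v) i 0.
  move=> <-; have /(congr1 (fun w : 'cV[C]_3 => w i 0)) := derM u v.
  by move=> /= ->; rewrite mxE.
have xy i := derM _ _ _ i (A_bracket_xy alpha).
have xz i := derM _ _ _ i (A_bracket_xz alpha).
have yz i := derM _ _ _ i (A_bracket_yz alpha).
have xE := mulmx_x M; have yE := mulmx_y M; have zE := mulmx_z M.
have xyE := mulmx_xy M; have zxE := mulmx_zx M.
have [x0 x1 x2] := x_coord; have [y0 y1 y2] := y_coord.
have [z0 z1 z2] := z_coord.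
move: (M *m (basis_x R + basis_y R)) (M *m (basis_z R + _)) xyE zxE xy xz yz.
move: (M *m basis_x R) (M *m basis_y R) (M *m basis_z R) xE yE zE.
move: (basis_x R) (basis_y R) (basis_z R) x0 x1 x2 y0 y1 y2 z0 z1 z2.
move=> x y z x0 x1 x2 y0 y1 y2 z0 z1 z2 Mx My Mz xE yE zE Mxy Mzx xyE zxE.
move=> xy xz yz; have mulE := (xyE, zxE, xE, yE, zE).
have brE := (A_bracket0, A_bracket1, A_bracket2).
have coordE := (x0, x1, x2, y0, y1, y2, z0, z1, z2).
have a2 : M i2 i0 = 0.
  apply: two_mul_inj; apply: (eq_of_subr (xy i2)).
  by rewrite !brE /minor !mulE !coordE; ring.
have b1 : M i1 i1 = 0.
  apply/esym; apply: (eq_of_subr (yz i2)).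
  by rewrite !brE /minor !mulE !coordE a2; ring.
have b2 : M i2 i1 = 0.
  apply/esym; apply: (eq_of_subr (xy i0)).
  by rewrite !brE /minor !mulE !coordE a2 b1; ring.
have a1 : M i1 i0 = 0.
  rewrite -b2; apply: (eq_of_subr (xy i1)).
  by rewrite !brE /minor !mulE !coordE; ring.
have c1 : M i1 i2 = M i0 i1.
  apply: (eq_of_subr (yz i1)).
  by rewrite !brE /minor !mulE !coordE a1; ring.
have c2 : M i2 i2 = 0.
  apply/esym; apply: (eq_of_subr (xz i0)).
  by rewrite !brE /minor !mulE !coordE a1 c1; ring.
have a0 : M i0 i0 = 0.
  apply/esym; apply: (eq_of_subr (xz i1)).
  by rewrite !brE /minor !mulE !coordE a1 b1 c2; ring.
have c0 : M i0 i2 = 2^-1 * M i0 i1.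
  apply: two_mul_inj; apply: (eq_of_subr (yz i0)).
  by rewrite !brE /minor !mulE !coordE a0 b1 c2; field.
apply: mulmx_inj => u; rewrite -scalemxAl.
have bNuE i : (M i0 i1 *: (N *m u)) i 0 = M i0 i1 * (N *m u) i 0.
  by rewrite mxE.
by apply: colE3; rewrite [LHS]mulmx3E bNuE der_genE
  ?(a0, a1, a2, b1, b2, c0, c1, c2); ring.
Qed.

(** * Automorphisms *)

Lemma flow_aut (b : C) : AutA alpha (flow b).
Proof.
split=> [|u v].
  exists (mulmx (flow (- b))) => u;
  by rewrite /mx_map /= mulmxA flowD ?addNr ?subrr flow0 mul1mx.
change (flow b *m A_bracket alpha u v
        = A_bracket alpha (flow b *m u) (flow b *m v)).
apply: colE3; rewrite !flowE !(A_bracket0, A_bracket1, A_bracket2) /minor;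
  rewrite !flowE; by field.
Qed.

(** Each of the three values of the form is the coefficient of one basis vector
    in the identity of [aut_omega] for the basis, so that freeness separates
    them. *)
Lemma aut_A_omega (M : 'M[C]_3) : AutA alpha M ->
  [/\ A_omega (M *m basis_y R) (M *m basis_z R) = -1,
      A_omega (M *m basis_z R) (M *m basis_x R) = 0 &
      A_omega (M *m basis_x R) (M *m basis_y R) = 0].
Proof.
move=> autM.
have omegaE : A_omega (basis_y R) (basis_z R) *: basis_x R
           + A_omega (basis_z R) (basis_x R) *: basis_y R
           + A_omega (basis_x R) (basis_y R) *: basis_z R
           = A_omega (M *m basis_y R) (M *m basis_z R) *: basis_x R
           + A_omega (M *m basis_z R) (M *m basis_x R) *: basis_y R
           + A_omega (M *m basis_x R) (M *m basis_y R) *: basis_z R.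
  exact: (aut_omega (A alpha) (mx_map alpha M) (basis_y R) (basis_z R)
    (basis_x R) autM).
have [<- <- <-] := basis_free _ _ _ _ _ _ omegaE.
split; first exact: (A_omega_yz alpha); last exact: (A_omega_xy alpha).
by rewrite A_omega_skew (A_omega_xz alpha : A_omega _ _ = _) oppr0.
Qed.

(** With a, b and c the columns of M, as in [der_eq]: preservation of omega puts
    the image of x on the line of x and gives one determinant equation, and the
    bracket relations then determine the remaining entries one at a time. *)
Lemma aut_eq (M : 'M[C]_3) : AutA alpha M -> M = flow (M i0 i1).
Proof.
move=> autM; have [/bij_inj M_inj MB] := autM.
have {}MB (u v w : 'cV[C]_3) i : A_bracket alpha u v = w ->
    (M *m w) i 0 = A_bracket alpha (M *m u) (M *m v) i 0.
  by move=> <-; exact: (congr1 (fun w : 'cV[C]_3 => w i 0) (MB u v)).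
have xy i := MB _ _ _ i (A_bracket_xy alpha).
have xz i := MB _ _ _ i (A_bracket_xz alpha).
have yz i := MB _ _ _ i (A_bracket_yz alpha).
have a0_neq0 : M i1 i0 = 0 -> M i2 i0 = 0 -> M i0 i0 != 0.
  move=> a1 a2; apply/eqP => a0; have /M_inj x_eq0 : M *m basis_x R = M *m 0.
    by rewrite mulmx0; apply: colE3; rewrite mulmx_x mxE.
  have [+ _ _] := x_coord; rewrite x_eq0 mxE => /esym/eqP.
  by rewrite oner_eq0.
have [omega_yz omega_zx omega_xy] := aut_A_omega _ autM.
have xE := mulmx_x M; have yE := mulmx_y M; have zE := mulmx_z M.
have xyE := mulmx_xy M; have zxE := mulmx_zx M.
move: (M *m (basis_x R + basis_y R)) (M *m (basis_z R + _)) xyE zxE xy xz yz.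
move: (M *m basis_x R) (M *m basis_y R) (M *m basis_z R) xE yE zE
  omega_yz omega_zx omega_xy.
move=> x y z xE yE zE omega_yz omega_zx omega_xy Mxy Mzx xyE zxE xy xz yz.
have mulE := (xyE, zxE, xE, yE, zE).
have brE := (A_bracket0, A_bracket1, A_bracket2).
have a_eq0 k : k = i1 \/ k = i2 -> M k i0 = 0.
  move=> k12.
  (* The determinant of M with its first row replaced by a copy of row k,
     expanded along that row and negated; omega is minus a 2 x 2 minor. *)
  have : M k i0 * A_omega y z + M k i1 * A_omega z x + M k i2 * A_omega x y = 0.
    by rewrite /A_omega /minor !mulE; case: k12 => ->; ring.
  rewrite omega_yz omega_zx omega_xy => /esym eq0.
  by apply: (eq_of_subr eq0); ring.
have a1 : M i1 i0 = 0 by apply: a_eq0; left.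
have a2 : M i2 i0 = 0 by apply: a_eq0; right.
have b2 : M i2 i1 = 0.
  apply: (mulfI (a0_neq0 a1 a2)); apply: (eq_of_subr (esym (xy i1))).
  by rewrite !brE /minor !mulE a1 a2; ring.
have b1 : M i1 i1 = 1.
  apply: (mulfI (a0_neq0 a1 a2)); apply: (eq_of_subr (esym (xy i0))).
  by rewrite !brE /minor !mulE a1 a2 b2; ring.
have c2 : M i2 i2 = 1.
  apply: (eq_of_subr (esym omega_yz)).
  by rewrite /A_omega /minor !mulE b1 b2; ring.
have a0 : M i0 i0 = 1.
  apply: (eq_of_subr (esym (xz i1))).
  by rewrite !brE /minor !mulE a1 a2 b1 c2; ring.
have c1 : M i1 i2 = M i0 i1.
  apply: (eq_of_subr (esym (xz i0))).
  by rewrite !brE /minor !mulE a0 a1 a2 c2; ring.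
have c0 : M i0 i2 = 2^-1 * (M i0 i1 ^+ 2 + M i0 i1).
  apply: two_mul_inj; apply: (eq_of_subr (yz i0)).
  by rewrite !brE /minor !mulE a0 b1 b2 c1 c2; field.
apply: mulmx_inj => u; apply: colE3; rewrite [LHS]mulmx3E flowE
  ?(a0, a1, a2, b1, b2, c0, c1, c2); ring.
Qed.

Lemma AutA_eq_range_flow : AutA alpha = range flow.
Proof.
apply/seteqP; split=> [M /aut_eq ->|_ [b _ <-]]; last exact: flow_aut.
by exists (M i0 i1).
Qed.

Lemma DerA_eq_line : DerA alpha = range (fun b => b *: N).
Proof.
apply/seteqP; split=> [M /der_eq ->|_ [b _ <-]]; last exact: der_gen_der.
by exists (M i0 i1).
Qed.

Lemma AutA_closed : closed (AutA alpha).
Proof.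
rewrite (_ : AutA alpha = [set M : 'M[C]_3 | M = flow (M i0 i1)]).
  exact: (closed_entry_graph (n := 2) i0 i1 flow flow_continuous).
by apply/seteqP; split=> M /=; [exact: aut_eq|move=> ->; exact: flow_aut].
Qed.

End Aalpha.

Theorem proposition4p3 (R : realType) (alpha : Cplx R) :
  [/\ matrix_lie_group (AutA alpha),
      path_connected (AutA alpha) &
      abelian_mx (AutA alpha)]
  /\ AutA alpha = [set expmx d | d in DerA alpha].
Proof.
split; last first.
  rewrite DerA_eq_line AutA_eq_range_flow image_comp; apply: eq_imagel => b _.
  by rewrite /= expmx_der_gen.
have AutE := AutA_eq_range_flow R alpha.
split.
- split; last exact: closed_subspaceW (AutA_closed R alpha).
  rewrite AutE; split=> [_ [b _ <-]||_ _ [b _ <-] [c _ <-]|_ [b _ <-]].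
  + exact: flow_unit.
  + by exists 0 => //; exact: flow0.
  + by exists (b + c) => //; rewrite flowD.
  + by exists (- b) => //; rewrite invmx_flow.
- rewrite AutE => _ _ [b _ <-] [c _ <-].
  exists (fun t : R => flow R (b + (t%:C)%C * (c - b))); split.
  + apply: continuous_subspaceT => t.
    apply: (@continuous_comp _ _ _
      (fun s : R => b + (s%:C)%C * (c - b)) (flow R)); last first.
      exact: flow_continuous.
    exact: continuous_affine continuous_real_complex t.
  + by rewrite rmorph0 mul0r addr0.
  + by rewrite rmorph1 mul1r addrC subrK.
  + by move=> t _; exists (b + (t%:C)%C * (c - b)).
- by rewrite AutE => _ _ [b _ <-] [c _ <-]; rewrite !flowD addrC.
Qed.
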